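(* There is an absolute constant $C>0$ such that for every integer $n\ge1$ and all reals $0<\varepsilon<1$, $0<\delta<1$ there exists a mergeable cardinality estimation data structure for the universe $[n]$ with relative accuracy $\varepsilon$ and failure probability $\delta$ whose space usage is at most $C\,(\ln(\delta^{-1})\varepsilon^{-2}+\ln n+1)$ bits.
   Context: $[n]:=\{0,\dots,n-1\}$. A mergeable cardinality estimation data structure for $[n]$ with relative accuracy $\varepsilon$ and failure probability $\delta$ consists of: a finite nonempty seed set $\Theta$ (seeds drawn uniformly at random), a set $S$ of sketches together with an injective encoding of sketches as finite bit strings, functions $\mathrm{single}:[n]\times\Theta\to S$, $\mathrm{merge}:S\times S\to S$, $\mathrm{estimate}:S\to\mathbb R$, and a map $\nu$ assigning to each $\theta\in\Theta$ and nonempty $A\subseteq[n]$ a sketch $\nu(\theta,A)\in S$, such that for all $\theta$, $x\in[n]$ and nonempty $A,B\subseteq[n]$: $\mathrm{single}(x,\theta)=\nu(\theta,\{x\})$ and $\mathrm{merge}(\nu(\theta,A),\nu(\theta,B))=\nu(\theta,A\cup B)$; and for every nonempty $A\subseteq[n]$, $\Pr_{\theta\sim U(\Theta)}\big(|\mathrm{estimate}(\nu(\theta,A))-|A||>\varepsilon|A|\big)\le\delta$. Its space usage is $\lceil\log_2|\Theta|\rceil$ plus the maximum, over all $\theta\in\Theta$ and nonempty $A\subseteq[n]$, of the bit length of the encoding of $\nu(\theta,A)$. *)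

(* Defs.v *)
From Stdlib Require Import Reals.
From mathcomp Require Import all_boot.
Set Implicit Arguments. Unset Strict Implicit. Unset Printing Implicit Defensive.

Local Open Scope R_scope.

Record MCE (n : nat) := MkMCE {
  seed : finType;                         (* Theta, seeds drawn uniformly *)
  sketch : Type;
  enc : sketch -> seq bool;
  enc_inj : injective enc;
  single : 'I_n -> seed -> sketch;
  merge : sketch -> sketch -> sketch;
  estimate : sketch -> R;
  nu : seed -> {set 'I_n} -> sketch       (* only used on nonempty A *)
}.

Definition bad_est (x : R) (a : nat) (eps : R) : bool :=
  if Rlt_dec (eps * INR a) (Rabs (x - INR a)) then true else false.

Definition fail_prob n (D : MCE n) (eps : R) (A : {set 'I_n}) : R :=
  (INR #|[set th : seed D | bad_est (estimate (nu th A)) #|A| eps]|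
     / INR #|seed D|)%R.

Definition is_MCE n (D : MCE n) (eps delta : R) : Prop :=
  (0 < #|seed D|)%N /\
  (forall (th : seed D) (x : 'I_n), single x th = nu th [set x]) /\
  (forall (th : seed D) (A B : {set 'I_n}), A != set0 -> B != set0 ->
      merge (nu th A) (nu th B) = nu th (A :|: B)) /\
  (forall A : {set 'I_n}, A != set0 -> (fail_prob D eps A <= delta)%R).

(* Space usage: ceil(log2 |Theta|) + max bit length of nu(theta, A), A nonempty.
   up_log 2 m is the least e with m <= 2^e, i.e. ceil(log2 m) for m >= 1. *)
Definition space n (D : MCE n) : nat :=
  up_log 2 #|seed D| +
  \max_(th : seed D) \max_(A : {set 'I_n} | A != set0) size (enc (nu th A)).

(* Main.v *)
(* Each of [m] independent buckets gives every element of the universe an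
   independent geometric level and keeps the maximal level over [A].  The sketch
   stores these maxima only above the least cutoff [q] for which the unary cost
   [\sum_j (t_j - q)] is below [m]; since this cost is monotone in [A], the
   truncated tables can be merged.  With [a := #|A|], a bucket stays below level
   [r] with probability [(1 - 2^-r)^a], so a Chernoff bound at the boundedly many
   levels [r] with [2^r] comparable to [a] gives relative accuracy [eps] once
   [m] is of order [ln (1 / delta) / eps^2].  The truly random table is replaced
   by one of [O(n / delta)] fixed tables, chosen by the probabilistic method so
   that all [2^n] sets are served.

   When [delta] is close to [1] the budget [ln (1 / delta) / eps^2] is of order
   [p / eps^2] with [p := 1 - delta], which is too small for that sketch.  There
   one uses accuracy of order [eps / p] with failure probability [1 / 2], and
   multiplies the estimate by one of [K], about [1 / (2 p)], random correction
   factors; if [p <= 1 / n] it suffices to guess the cardinality. *)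

Require Import Defs.
From HB Require Import structures.
From Stdlib Require Import ZArith Reals Lra Lia Classical.
From mathcomp Require Import all_boot zify.
Set Implicit Arguments. Unset Strict Implicit. Unset Printing Implicit Defensive.
Local Open Scope R_scope.

(** * Means over finite uniform spaces *)

Lemma Rplus_associative : associative Rplus. Proof. by move=> x y z; lra. Qed.
Lemma Rmult_associative : associative Rmult. Proof. by move=> x y z; ring. Qed.
HB.instance Definition _ := Monoid.isComLaw.Build R 0 Rplus
  Rplus_associative Rplus_comm Rplus_0_l.
HB.instance Definition _ := Monoid.isComLaw.Build R 1 Rmult
  Rmult_associative Rmult_comm Rmult_1_l.
HB.instance Definition _ := Monoid.isMulLaw.Build R 0 Rmult Rmult_0_l Rmult_0_r.
HB.instance Definition _ := Monoid.isAddLaw.Build R Rmult Rplus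
  Rmult_plus_distr_r Rmult_plus_distr_l.

Local Notation "\rsum_ ( i : t ) F" := (\big[Rplus/0]_(i : t) F)
  (at level 41, F at level 41, i at level 50).
Local Notation "\rsum_ ( i 'in' A ) F" := (\big[Rplus/0]_(i in A) F)
  (at level 41, F at level 41, i, A at level 50).
Local Notation "\rprod_ ( i : t ) F" := (\big[Rmult/1]_(i : t) F)
  (at level 36, F at level 36, i at level 50).

Lemma rsum_const (T : finType) (P : pred T) (c : R) :
  \big[Rplus/0]_(i | P i) c = INR #|P| * c.
Proof.
rewrite big_const; elim: #|P| => [|k IH]; first by rewrite /=; lra.
by rewrite iterS IH S_INR; lra.
Qed.

Lemma rprod_const (T : finType) (c : R) (P : pred T) :
  \big[Rmult/1]_(i | P i) c = c ^ #|P|.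
Proof. by rewrite big_const; elim: #|P| => [|k IH] //=; rewrite IH. Qed.

Lemma rsum_le (T : finType) (P : pred T) (f g : T -> R) :
  (forall i, P i -> f i <= g i) ->
  \big[Rplus/0]_(i | P i) f i <= \big[Rplus/0]_(i | P i) g i.
Proof.
by move=> H; elim/big_ind2: _ => // [|x1 x2 y1 y2]; lra.
Qed.

Lemma rsum_count (T : finType) (P : pred T) :
  \rsum_(w : T) INR (P w) = INR #|[set w | P w]|.
Proof.
rewrite cardsE -sum1_card (big_morph INR plus_INR (erefl _)) [RHS]big_mkcond.
by apply: eq_bigr => w _; rewrite -topredE /=; case: (P w).
Qed.

Definition mean (T : finType) (f : T -> R) : R := (\rsum_(w : T) f w) / INR #|T|.

Definition prob (T : finType) (P : pred T) : R := mean (fun w => INR (P w)).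

Lemma INR_card_gt0 (T : finType) : (0 < #|T|)%N -> 0 < INR #|T|.
Proof. by move=> h; apply: lt_0_INR; lia. Qed.

Section Mean.
Variables (T : finType).
Hypothesis T0 : (0 < #|T|)%N.

Lemma mean_le (f g : T -> R) : (forall w, f w <= g w) -> mean f <= mean g.
Proof.
move=> H; rewrite /mean; apply: Rmult_le_compat_r.
  by apply: Rlt_le; apply: Rinv_0_lt_compat; exact: INR_card_gt0.
by apply: rsum_le => i _.
Qed.

Lemma eq_mean (f g : T -> R) : f =1 g -> mean f = mean g.
Proof. by move=> H; rewrite /mean; congr (_ / _); apply: eq_bigr => i _. Qed.

Lemma mean_const c : mean (fun _ : T => c) = c.
Proof.
rewrite /mean rsum_const -[#|_|]/(#|T|); have := INR_card_gt0 T0.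
by move=> h; field; apply: Rgt_not_eq.
Qed.

Lemma meanD (f g : T -> R) : mean (fun w => f w + g w) = mean f + mean g.
Proof. by rewrite /mean big_split /Rdiv Rmult_plus_distr_r. Qed.

Lemma meanZ c (f : T -> R) : mean (fun w => c * f w) = c * mean f.
Proof. by rewrite /mean -big_distrr /Rdiv Rmult_assoc. Qed.

Lemma mean_sum (I : finType) (f : I -> T -> R) :
  mean (fun w => \rsum_(i : I) f i w) = \rsum_(i : I) mean (f i).
Proof. by rewrite /mean /Rdiv exchange_big big_distrl. Qed.

Lemma prob_ge0 (P : pred T) : 0 <= prob P.
Proof.
rewrite -[X in X <= _](mean_const 0); apply: mean_le => w; exact: pos_INR.
Qed.

Lemma prob_le1 (P : pred T) : prob P <= 1.
Proof.
rewrite -[X in _ <= X](mean_const 1); apply: mean_le => w.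
by case: (P w) => /=; lra.
Qed.

Lemma prob_card (P : pred T) : prob P = INR #|[set w | P w]| / INR #|T|.
Proof. by rewrite /prob /mean rsum_count. Qed.

Lemma prob_le_mean (P : pred T) (f : T -> R) :
  (forall w, 0 <= f w) -> (forall w, P w -> 1 <= f w) -> prob P <= mean f.
Proof.
move=> f0 f1; apply: mean_le => w.
by case E: (P w) => /=; [apply: f1 | apply: f0].
Qed.

Lemma prob_le (P Q : pred T) : (forall w, P w -> Q w) -> prob P <= prob Q.
Proof.
move=> H; apply: prob_le_mean => [w|w /H ->]; first exact: pos_INR.
by rewrite /=; lra.
Qed.

Lemma prob_not (P : pred T) : prob (fun w => ~~ P w) = 1 - prob P.
Proof.
have <- : prob P + prob (fun w => ~~ P w) = 1; last by ring.
rewrite -meanD -[RHS](mean_const 1); apply: eq_mean => w.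
by case: (P w) => /=; lra.
Qed.

Lemma prob_or (P Q : pred T) : prob (fun w => P w || Q w) <= prob P + prob Q.
Proof.
rewrite -meanD; apply: mean_le => w.
by case: (P w); case: (Q w) => /=; lra.
Qed.

Lemma prob_exists (I : finType) (D : {pred I}) (P : I -> pred T) (b : R) :
  (forall i, i \in D -> prob (P i) <= b) ->
  prob (fun w => [exists i in D, P i w]) <= INR #|D| * b.
Proof.
move=> H.
apply: (Rle_trans _ (\rsum_(i in D) prob (P i))); last first.
  by rewrite -(rsum_const (mem D)); apply: rsum_le.
rewrite big_mkcond.
apply: (Rle_trans _ (\rsum_(i : I) mean (fun w => INR ((i \in D) && P i w)))).
  rewrite -mean_sum; apply: prob_le_mean => w.
    by elim/big_ind: _ => // [|x y|i _]; [lra | lra | exact: pos_INR].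
  case/existsP=> i Hi; rewrite (bigD1 i) //= Hi /=.
  set s := \big[_/_]_(_ | _) _; suff: 0 <= s by lra.
  by rewrite /s; elim/big_ind: _ => // [|x y|j _]; [lra | lra | exact: pos_INR].
apply: rsum_le => i _; case: (i \in D) => /=; first exact: Rle_refl.
by rewrite mean_const; lra.
Qed.

End Mean.

Lemma card_ffun_gt0 (I T : finType) : (0 < #|T|)%N -> (0 < #|{ffun I -> T}|)%N.
Proof. by move=> h; rewrite card_ffun expn_gt0 h. Qed.

Lemma INR_expn a b : INR (a ^ b)%N = INR a ^ b.
Proof. by elim: b => //= b IH; rewrite expnS mult_INR IH. Qed.

(** Independence: under a uniform function the coordinates are independent and uniform. Formally, a
    product of sums expands into a sum over functions. *)
Lemma mean_prod (I T : finType) (f : I -> T -> R) :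
  mean (fun w : {ffun I -> T} => \rprod_(i : I) f i (w i))
  = \rprod_(i : I) mean (f i).
Proof.
rewrite /mean /Rdiv -(bigA_distr_bigA (times := Rmult) (plus := Rplus)).
rewrite big_split /= rprod_const; congr (_ * _).
by rewrite card_ffun INR_expn pow_inv.
Qed.

(** * Chernoff bound and derandomization *)

Definition ltRb (x y : R) : bool := if Rlt_dec x y then true else false.

Lemma ltRbP x y : reflect (x < y) (ltRb x y).
Proof. by rewrite /ltRb; case: Rlt_dec => h; constructor. Qed.

Lemma exp_mulINR k x : exp (INR k * x) = exp x ^ k.
Proof.
elim: k => [|k IH]; first by rewrite Rmult_0_l exp_0.
by rewrite S_INR Rmult_plus_distr_r Rmult_1_l exp_plus IH /= Rmult_comm.
Qed.

Lemma exp_le x y : x <= y -> exp x <= exp y.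
Proof.
by case/Rle_lt_or_eq_dec => [/exp_increasing|->]; [lra | exact: Rle_refl].
Qed.

Lemma ln_le x y : 0 < x -> x <= y -> ln x <= ln y.
Proof.
move=> x0 /Rle_lt_or_eq_dec [/(ln_increasing _ _ x0)|->]; first lra.
exact: Rle_refl.
Qed.

(** From [exp (- y) >= 1 - y] one gets [exp y <= 1 / (1 - y)], and [(1 - y) (1 + y + 2 y^2) = 1 +
    y^2 (1 - 2 y) >= 1]. *)
Lemma exp_le_quadratic y : y <= / 2 -> exp y <= 1 + y + 2 * y ^ 2.
Proof.
move=> hy; have h := exp_ineq1_le (- y); rewrite exp_Ropp in h.
have e0 := exp_pos y.
have h1 : exp y * (1 - y) <= 1.
  rewrite -[X in _ <= X](Rinv_r (exp y)); last lra.
  by apply: Rmult_le_compat_l; lra.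
apply: (Rmult_le_reg_r (1 - y)); first lra.
have : 0 <= y ^ 2 * (1 - 2 * y) by apply: Rmult_le_pos; [exact: pow2_ge_0 | lra].
nra.
Qed.

Lemma exp_sum (I : finType) (f : I -> R) :
  exp (\rsum_(i : I) f i) = \rprod_(i : I) exp (f i).
Proof. exact: (big_morph exp exp_plus exp_0). Qed.

Section Chernoff.
Variables (T : finType) (P : pred T).
Hypothesis T0 : (0 < #|T|)%N.
Let p := prob P.

Lemma bernoulli_mgf l : Rabs l <= / 2 ->
  mean (fun w => exp (l * (INR (P w) - p))) <= exp (l ^ 2 / 2).
Proof.
move=> hl; have p0 : 0 <= p by exact: prob_ge0.
have p1 : p <= 1 by exact: prob_le1.
(* An indicator equals its own square, so the quadratic bound on the exponential is affine in it:
   [a + b * INR (P w)]. Its mean is [1 + 2 l^2 p (1 - p)], at most [1 + l^2 / 2]. *)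
pose a := 1 - l * p + 2 * l ^ 2 * p ^ 2.
pose b := l + 2 * l ^ 2 - 4 * l ^ 2 * p.
have hab w : exp (l * (INR (P w) - p)) <= a + b * INR (P w).
  have := @exp_le_quadratic (l * (INR (P w) - p)).
  have h : l * (INR (P w) - p) <= / 2.
    case: (P w) => /=; move: hl; rewrite /Rabs; case: Rcase_abs; nra.
  by move=> /(_ h) /Rle_trans; apply; rewrite /a /b; case: (P w) => /=; nra.
apply: Rle_trans (mean_le T0 hab) _.
rewrite meanD meanZ mean_const // -/(prob P) -/p.
apply: Rle_trans (exp_ineq1_le _); rewrite /a /b.
have : 0 <= l ^ 2 * (1 - 2 * p) ^ 2 by apply: Rmult_le_pos; exact: pow2_ge_0.
nra.
Qed.

Lemma count_mgf (I : finType) l : Rabs l <= / 2 ->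
  mean (fun w : {ffun I -> T} =>
    exp (l * (INR #|[set i | P (w i)]| - INR #|I| * p)))
  <= exp (INR #|I| * (l ^ 2 / 2)).
Proof.
move=> hl.
rewrite (@eq_mean _ _ (fun w : {ffun I -> T} =>
   \rprod_(i : I) exp (l * (INR (P (w i)) - p)))); last first.
  move=> w; rewrite -exp_sum -big_distrr big_split /= rsum_const.
  by rewrite -rsum_count -[#|_|]/(#|I|); congr (exp (_ * (_ + _))); ring.
rewrite (mean_prod (fun _ x => exp (l * (INR (P x) - p)))).
rewrite rprod_const exp_mulINR -[#|_|]/(#|I|); apply: pow_incr; split.
  rewrite -(mean_const T0 0); apply: mean_le => // w; apply: Rlt_le; exact: exp_pos.
exact: bernoulli_mgf.
Qed.

(** Exponential Markov inequality at [l = t] and [l = - t], one for each tail; [l = t] minimises the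
    exponent [l^2 / 2 - l t]. *)
Lemma chernoff (I : finType) t : 0 < t <= / 2 ->
  prob (fun w : {ffun I -> T} =>
    ltRb (INR #|I| * t) (Rabs (INR #|[set i | P (w i)]| - INR #|I| * p)))
  <= 2 * exp (- (INR #|I| * (t ^ 2 / 2))).
Proof.
move=> ht.
have aux m x : m * t < Rabs x ->
    0 <= - (m * t ^ 2) + t * x \/ 0 <= - (m * t ^ 2) + - t * x.
  by rewrite /Rabs; case: Rcase_abs => h hx; [right|left]; nra.
set m := INR #|I|.
pose X (w : {ffun I -> T}) := INR #|[set i | P (w i)]| - m * p.
apply: (Rle_trans _ (mean (fun w : {ffun I -> T} =>
   exp (- (m * t ^ 2)) * (exp (t * X w) + exp (- t * X w))))).
  apply: prob_le_mean => [|w|w]; first exact: card_ffun_gt0.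
    apply: Rmult_le_pos; first exact: Rlt_le (exp_pos _).
    by have := exp_pos (t * X w); have := exp_pos (- t * X w); lra.
  move/ltRbP; rewrite -/m -/(X w) Rmult_plus_distr_l -!exp_plus => hX.
  have [h|h] : 0 <= - (m * t ^ 2) + t * X w \/ 0 <= - (m * t ^ 2) + - t * X w.
  - exact: aux.
  - have := exp_ineq1_le (- (m * t ^ 2) + t * X w).
    by have := exp_pos (- (m * t ^ 2) + - t * X w); lra.
  - have := exp_ineq1_le (- (m * t ^ 2) + - t * X w).
    by have := exp_pos (- (m * t ^ 2) + t * X w); lra.
rewrite meanZ meanD.
have h1 := @count_mgf I t; have h2 := @count_mgf I (- t).
have {}h1 := h1 ltac:(rewrite Rabs_right; lra).
have {}h2 := h2 ltac:(rewrite Rabs_Ropp Rabs_right; lra).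
rewrite -/m in h1 h2; rewrite (_ : (- t) ^ 2 = t ^ 2) in h2; last by ring.
have -> : - (m * (t ^ 2 / 2)) = - (m * t ^ 2) + m * (t ^ 2 / 2) by field.
rewrite exp_plus [X in _ <= X](_ : _ = exp (- (m * t ^ 2)) *
  (exp (m * (t ^ 2 / 2)) + exp (m * (t ^ 2 / 2)))); last by ring.
apply: Rmult_le_compat_l; first exact: Rlt_le (exp_pos _).
exact: Rplus_le_compat.
Qed.

End Chernoff.

(** Draw the [N] samples independently. For fixed [i], the exponential moment of the number of bad
    samples is at most [exp (d N / 2)], so more than [d N] are bad with probability at most
    [exp (- d N / 2) <= exp (- n)]. A union bound over at most [2^n] indices leaves total failure
    [(2 / e)^n < 1]. *)
Lemma derandomize (T I : finType) (bad : I -> pred T) (n N : nat) (d : R) :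
  (0 < #|T|)%N -> (0 < n)%N -> (#|I| <= 2 ^ n)%N ->
  (forall i, prob (bad i) <= d / 4) -> 2 * INR n <= d * INR N ->
  exists s : {ffun 'I_N -> T},
    forall i, INR #|[set k | bad i (s k)]| <= d * INR N.
Proof.
move=> T0 n0 cI hbad hN; apply: NNPP => H.
pose F := {ffun 'I_N -> T}.
have F0 : (0 < #|F|)%N by exact: card_ffun_gt0.
pose Q i (s : F) := ltRb (d * INR N) (INR #|[set k | bad i (s k)]|).
have h1 : 1 <= prob (fun s => [exists i in I, Q i s]).
  rewrite -{1}(mean_const F0 1); apply: mean_le => // s.
  suff -> : [exists i in I, Q i s] by rewrite /=; lra.
  apply/existsP; apply: NNPP => H1; apply: H; exists s => i.
  by apply: Rnot_lt_le => /ltRbP h; apply: H1; exists i.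
have h2 i : prob (Q i) <= exp (- INR n).
  apply: (Rle_trans _ (mean (fun s : F =>
      exp (- (d * INR N)) * \rprod_(k : 'I_N) exp (INR (bad i (s k)))))).
    apply: prob_le_mean => // s.
      by rewrite -exp_sum -exp_plus; apply: Rlt_le; exact: exp_pos.
    move=> /ltRbP h; rewrite -exp_sum -exp_plus rsum_count -exp_0.
    by apply: exp_le; lra.
  rewrite meanZ (mean_prod (fun _ x => exp (INR (bad i x)))) rprod_const.
  rewrite -[#|_|]/(#|'I_N|) card_ord.
  have h3 : mean (fun w => exp (INR (bad i w))) <= exp (d / 2).
    (* On the values 0 and 1, [exp x <= 1 + 2 x] because [e <= 3]; this turns [d / 4] into
       [d / 2]. *)
    apply: (Rle_trans _ (mean (fun w => 1 + 2 * INR (bad i w)))).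
      apply: mean_le => // w; have e3 := exp_le_3.
      by case: (bad i w); rewrite /= ?exp_0; lra.
    rewrite meanD meanZ mean_const // -/(prob (bad i)).
    by apply: Rle_trans (exp_ineq1_le _); have := hbad i; lra.
  apply: (Rle_trans _ (exp (- (d * INR N)) * exp (d / 2) ^ N)).
    apply: Rmult_le_compat_l; first exact: Rlt_le (exp_pos _).
    apply: pow_incr; split => //.
    by rewrite -(mean_const T0 0); apply: mean_le => // w; apply: Rlt_le (exp_pos _).
  rewrite -exp_mulINR -exp_plus; apply: exp_le; lra.
have h3 : 1 <= INR #|I| * exp (- INR n).
  apply: (Rle_trans _ _ _ h1).
  exact: (prob_exists F0 (D := I) (P := Q) (fun i _ => h2 i)).
have h4 : INR #|I| <= 2 ^ n.
  by rewrite -[2]/(INR 2) -INR_expn; apply: le_INR; apply/leP.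
have h5 : 2 ^ n * exp (- INR n) < 1.
  have -> : - INR n = INR n * Ropp 1 by ring.
  rewrite exp_mulINR -Rpow_mult_distr exp_Ropp.
  have e1 := exp_ineq1 1 ltac:(lra).
  apply: (proj2 (pow_lt_1_compat _ _ _ _)); last lia; split.
    by apply: Rmult_le_pos; [lra | apply: Rlt_le; apply: Rinv_0_lt_compat; lra].
  by apply: (Rmult_lt_reg_r (exp 1)); [lra | rewrite Rmult_assoc Rinv_l; lra].
have := Rmult_le_compat_r _ _ _ (Rlt_le _ _ (exp_pos (- INR n))) h4.
lra.
Qed.

(** * Truncated tables *)

Section Packing.
Variable m : nat.
Implicit Types t v : {ffun 'I_m -> nat}.
Local Open Scope nat_scope.

Definition excess t (q : nat) : nat := \sum_(j < m) (t j - q).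

Lemma excess_bound t q : (forall j, t j <= q) -> excess t q = 0.
Proof. by move=> h; rewrite /excess big1 // => j _; have := h j; lia. Qed.

Lemma leq_max_ffun t j : t j <= \max_(i < m) t i.
Proof. exact: (leq_bigmax j). Qed.

Lemma cutoff_exists t : exists q, excess t q <= m.-1.
Proof. by exists (\max_(i < m) t i); rewrite excess_bound //; exact: leq_max_ffun. Qed.

Definition cutoff t : nat := ex_minn (cutoff_exists t).

Definition pack t : nat * {ffun 'I_m -> nat} :=
  (cutoff t, [ffun j => t j - cutoff t]).

(** Not an inverse of [pack]: entries below the cutoff come back raised to it. *)
Definition unpack (s : nat * {ffun 'I_m -> nat}) : {ffun 'I_m -> nat} :=
  [ffun j => s.2 j + s.1].

Definition ffun_max t v : {ffun 'I_m -> nat} := [ffun j => maxn (t j) (v j)].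

Lemma cutoffP t : excess t (cutoff t) <= m.-1.
Proof. by rewrite /cutoff; case: ex_minnP. Qed.

Lemma cutoff_le t q : excess t q <= m.-1 -> cutoff t <= q.
Proof. by rewrite /cutoff; case: ex_minnP => c _ h /h. Qed.

Lemma cutoff_bound t q : (forall j, t j <= q) -> cutoff t <= q.
Proof. by move=> h; apply: cutoff_le; rewrite excess_bound. Qed.

Lemma leq_excess t v q : (forall j, t j <= v j) -> excess t q <= excess v q.
Proof. by move=> h; apply: leq_sum => j _; have := h j; lia. Qed.

Lemma leq_cutoff t v : (forall j, t j <= v j) -> cutoff t <= cutoff v.
Proof. by move=> h; apply: cutoff_le; apply: leq_trans (leq_excess _ h) (cutoffP v). Qed.

Lemma unpack_pack t j : unpack (pack t) j = maxn (t j) (cutoff t).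
Proof. by rewrite !ffunE /=; lia. Qed.

(* The bound [m.-1] (rather than [m]) makes every [q] below the common floor
   of an unpacked table infeasible, so flooring never lowers the cutoff. *)
Lemma pack_floor t v c : 0 < m -> c <= cutoff t ->
  (forall j, v j = maxn (t j) c) -> pack v = pack t.
Proof.
move=> m0 hc hv.
have hvt q : c <= q -> excess v q = excess t q.
  by move=> hq; apply: eq_bigr => j _; rewrite hv; lia.
have cv : c <= cutoff v.
  rewrite leqNgt; apply/negP => h.
  have := cutoffP v; apply/negP; rewrite -ltnNge.
  have -> : m.-1 < excess v (cutoff v) = (m <= excess v (cutoff v)) by lia.
  rewrite -[leqLHS]card_ord -sum1_card; apply: leq_sum => j _.
  by rewrite hv; lia.
have e : cutoff v = cutoff t.
  apply/eqP; rewrite eqn_leq; apply/andP; split; apply: cutoff_le.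
    by rewrite hvt // cutoffP.
  by rewrite -hvt // cutoffP.
by rewrite /pack e; congr (_, _); apply/ffunP => j; rewrite !ffunE hv; lia.
Qed.

Definition merge_packed s s' := pack (ffun_max (unpack s) (unpack s')).

(** The maximum of the two floored tables is the true maximum floored at the larger cutoff. By
    monotonicity this floor is at most the cutoff of the true maximum, so [pack_floor] applies. *)
Lemma merge_pack t v : 0 < m ->
  merge_packed (pack t) (pack v) = pack (ffun_max t v).
Proof.
move=> m0; apply: (@pack_floor _ _ (maxn (cutoff t) (cutoff v))) => //.
  by rewrite geq_max; apply/andP; split; apply: leq_cutoff => j; rewrite ffunE; lia.
by move=> j; rewrite !(ffunE, unpack_pack) /=; lia.
Qed.

Definition below t r : nat := #|[set j | t j < r]|.

Lemma leq_below t r r' : r <= r' -> below t r <= below t r'.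
Proof. by move=> h; apply: subset_leq_card; apply/subsetP => j; rewrite !inE; lia. Qed.

Lemma below_floor t r :
  below (unpack (pack t)) r = if r <= cutoff t then 0 else below t r.
Proof.
rewrite /below; case: ifP => h.
  apply/eqP; rewrite cards_eq0; apply/eqP/setP => j.
  by rewrite !inE unpack_pack; apply/negbTE; lia.
by apply: eq_card => j; rewrite !inE unpack_pack; lia.
Qed.

Lemma est_level_exists t : exists r, m <= 4 * below t r.
Proof.
exists (\max_(i < m) t i).+1; rewrite /below.
have -> : [set j | t j < (\max_(i < m) t i).+1] = setT.
  by apply/setP => j; rewrite !inE ltnS leq_max_ffun.
by rewrite cardsT card_ord; lia.
Qed.

(** With a quarter of the buckets below the chosen level, the observed fraction stays away from 0,
    where the logarithm is not Lipschitz; minimality keeps the level from being too high for the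
    set. *)
Definition est_level t : nat := ex_minn (est_level_exists t).

Lemma est_levelP t : m <= 4 * below t (est_level t).
Proof. by rewrite /est_level; case: ex_minnP. Qed.

Lemma est_level_le t r : m <= 4 * below t r -> est_level t <= r.
Proof. by rewrite /est_level; case: ex_minnP => c _ h /h. Qed.

(** * Unary encoding of packed tables *)

Definition unary (s : seq nat) : seq bool :=
  flatten [seq rcons (nseq k true) false | k <- s].

Lemma unary_inj : injective unary.
Proof.
elim=> [|k s IH] [|k' s'] //=; try by case: k || case: k'.
rewrite /unary /= !cat_rcons.
elim: k k' => [|k IHk] [|k'] //=; first by case=> /IH ->.
by case=> /IHk [-> ->].
Qed.

Lemma size_unary s : size (unary s) = sumn s + size s.
Proof.
elim: s => //= k s IH.
by rewrite /unary /= size_cat size_rcons size_nseq -/(unary s) IH; lia.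
Qed.

Definition enc_packed (s : nat * {ffun 'I_m -> nat}) : seq bool :=
  unary (s.1 :: [seq s.2 j | j <- enum 'I_m]).

Lemma enc_packed_inj : injective enc_packed.
Proof.
move=> [q u] [q' u'] /unary_inj /= [-> /eq_in_map h]; congr (_, _).
by apply/ffunP => j; apply: h; rewrite mem_enum.
Qed.

(** The cutoff costs at most [L] ones, the excesses at most [m - 1], and there are [m + 1]
    terminating zeros. *)
Lemma size_enc_pack t L : 0 < m -> (forall j, t j <= L) ->
  size (enc_packed (pack t)) <= L + 2 * m.
Proof.
move=> m0 hL; rewrite /enc_packed size_unary /= size_map size_enum_ord.
set u := sumn _; have -> : u = excess t (cutoff t).
  by rewrite /u sumnE big_map big_enum /=; apply: eq_bigr => j _; rewrite ffunE.
by have := cutoff_bound hL; have := cutoffP t; lia.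
Qed.

End Packing.

(** The solution [a] of [ph = (1 - 2^-r)^a], where [ph] is the fraction of buckets below the level
    [r := est_level v]. *)
Definition estimator m (v : {ffun 'I_m -> nat}) : R :=
  ln (INR (below v (est_level v)) / INR m) / ln (1 - / 2 ^ est_level v).

Lemma Rabs_le_inv x c : Rabs x <= c -> - c <= x <= c.
Proof. by rewrite /Rabs; case: Rcase_abs; lra. Qed.

Lemma bernoulli_ineq y k : 0 <= y <= 1 -> 1 - INR k * y <= (1 - y) ^ k.
Proof.
move=> hy; elim: k => [|k IH]; first by rewrite /=; lra.
rewrite S_INR /=; have := pos_INR k => hk.
case: (Rle_dec 0 (1 - INR k * y)) => h; first nra.
have : 0 <= (1 - y) ^ k by apply: pow_le; lra.
nra.
Qed.

Lemma pow_le_inv y k : 0 <= y <= 1 -> (1 - y) ^ k <= / (1 + INR k * y).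
Proof.
move=> hy; have := pos_INR k => hk.
have h0 : 0 < 1 + INR k * y by nra.
apply: (Rle_trans _ (exp (INR k * - y))).
  rewrite exp_mulINR; apply: pow_incr; have := exp_ineq1_le (- y); lra.
rewrite (_ : INR k * - y = - (INR k * y)); last by ring.
rewrite exp_Ropp; apply: Rinv_le_contravar => //; exact: exp_ineq1_le.
Qed.

Lemma ln_le_sub1 x : 0 < x -> ln x <= x - 1.
Proof. by move=> h; have := exp_ineq1_le (ln x); rewrite exp_ln //; lra. Qed.

Lemma ln_lipschitz c x y : 0 < c -> c <= x -> c <= y ->
  Rabs (ln x - ln y) <= Rabs (x - y) / c.
Proof.
move=> c0.
have H u v : c <= u -> c <= v -> ln u - ln v <= Rabs (u - v) / c.
  move=> hu hv.
  have := @ln_le_sub1 (u / v) (Rdiv_lt_0_compat u v ltac:(lra) ltac:(lra)).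
  rewrite /Rdiv ln_mult; [|lra|by apply: Rinv_0_lt_compat; lra].
  rewrite ln_Rinv; last lra.
  have -> : u * / v - 1 = (u - v) * / v by field; lra.
  have h1 : (u - v) * / v <= Rabs (u - v) * / v.
    apply: Rmult_le_compat_r; last exact: Rle_abs.
    by apply: Rlt_le; apply: Rinv_0_lt_compat; lra.
  have h2 : Rabs (u - v) * / v <= Rabs (u - v) * / c.
    apply: Rmult_le_compat_l; first exact: Rabs_pos.
    by apply: Rinv_le_contravar.
  lra.
move=> hx hy; have h1 := H x y hx hy; have h2 := H y x hy hx.
rewrite Rabs_minus_sym in h2.
by apply: Rabs_le; lra.
Qed.

(** Concentration at the listed levels forces [est_level] to be one of them. There the logarithm is
    8-Lipschitz on the relevant fractions, so its error is at most [eps / 16]; dividing by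
    [- ln (1 - 2^-r) >= 1 / (16 a)] gives at most [eps a]. *)
Lemma estimator_accurate m (t : {ffun 'I_m -> nat}) (a r0 : nat) (eps : R) :
  (0 < m)%N -> (0 < a)%N -> 0 < eps < 1 ->
  (4 * a <= 2 ^ r0 < 8 * a)%N -> (cutoff t <= r0)%N ->
  (forall r, (r0 - 6 <= r <= r0.+1)%N ->
    Rabs (INR (below t r) - INR m * (1 - / 2 ^ r) ^ a) <= INR m * (eps / 128)) ->
  Rabs (estimator (unpack (pack t)) - INR a) <= eps * INR a.
Proof.
move=> m0 a0 heps /andP[ha1 ha2] hc hdev.
have mR : 0 < INR m by apply: lt_0_INR; lia.
have aR : 0 < INR a by apply: lt_0_INR; lia.
have P0 r : 0 < 2 ^ r by apply: pow_lt; lra.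
have P1 r : 0 < / 2 ^ r <= 1.
  split; first by apply: Rinv_0_lt_compat.
  rewrite -Rinv_1; apply: Rinv_le_contravar; first lra.
  by apply: pow_R1_Rle; lra.
have E2 r : INR (2 ^ r)%N = 2 ^ r by rewrite INR_expn.
have N4 : INR 4 = 4 by rewrite /=; ring.
have N8 : INR 8 = 8 by rewrite /=; ring.
have ha1' : 4 * INR a <= 2 ^ r0.
  by rewrite -E2 -N4 -mult_INR; apply: le_INR; lia.
have ha2' : 2 ^ r0 < 8 * INR a.
  by rewrite -E2 -N8 -mult_INR; apply: lt_INR; lia.
set v := unpack (pack t); set r := est_level v.
(* At [r0.+1], above the cutoff, the expected fraction is at least 7/8, well over a quarter. *)
have r_le : (r <= r0.+1)%N.
  apply: est_level_le; rewrite /v below_floor ifF; last by apply/negbTE; lia.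
  apply/leP; apply: INR_le; rewrite mult_INR.
  have /hdev : (r0 - 6 <= r0.+1 <= r0.+1)%N by lia.
  move/Rabs_le_inv.
  have := @bernoulli_ineq (/ 2 ^ r0.+1) a ltac:(have := P1 r0.+1; lra).
  have : INR a * / 2 ^ r0.+1 <= / 8.
    apply: (Rmult_le_reg_r (2 ^ r0.+1)) => //.
    rewrite Rmult_assoc Rinv_l; last by have := P0 r0.+1; lra.
    by rewrite /=; lra.
  rewrite N4; nra.
have r_ok : (m <= 4 * below v r)%N by exact: est_levelP.
have r_gt : (cutoff t < r)%N.
  rewrite ltnNge; apply/negP => h; move: r_ok.
  by rewrite /v below_floor h; lia.
have vE : below v r = below t r by rewrite /v below_floor ifF //; apply/negbTE; lia.
have r_ok' : INR m <= 4 * INR (below t r).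
  by rewrite -vE -N4 -mult_INR; apply: le_INR; lia.
(* Otherwise [r0 > 6], so the subtraction is exact and [a / 2^(r0 - 6) > 8]; the expected fraction
   at [r0 - 6] is then at most 1/9, too small for a quarter even after the deviation. *)
have r_ge : (r0 - 6 <= r)%N.
  rewrite leqNgt; apply/negP => h.
  have /hdev /Rabs_le_inv : (r0 - 6 <= r0 - 6 <= r0.+1)%N by lia.
  have : INR (below t r) <= INR (below t (r0 - 6)).
    by apply: le_INR; apply/leP; apply: leq_below; lia.
  have := @pow_le_inv (/ 2 ^ (r0 - 6)) a ltac:(have := P1 (r0 - 6)%N; lra).
  have : / (1 + INR a * / 2 ^ (r0 - 6)) <= / 9.
    apply: Rinv_le_contravar; first lra.
    suff : 8 <= INR a * / 2 ^ (r0 - 6) by lra.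
    apply: (Rmult_le_reg_r (2 ^ (r0 - 6))) => //.
    rewrite Rmult_assoc Rinv_l; last by have := P0 (r0 - 6)%N; lra.
    have : 2 ^ r0 = 2 ^ (r0 - 6) * 64.
      by rewrite -[in LHS](@subnK 6 r0) ?pow_add; [rewrite /=; ring | lia].
    lra.
  nra.
have dev := hdev r ltac:(lia).
set y := ln (1 - / 2 ^ r).
(* [r] exceeds the cutoff, hence is positive, and [ln] is not taken at 0. *)
have r1 : / 2 ^ r <= / 2.
  apply: Rinv_le_contravar; first lra.
  have -> : r = r.-1.+1 by lia.
  by have := @pow_R1_Rle 2 r.-1; rewrite /=; lra.
have hy : y <= - / 2 ^ r.
  by have := @ln_le_sub1 (1 - / 2 ^ r); rewrite -/y; lra.
have hay : / 16 <= INR a * - y.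
  apply: (Rle_trans _ (INR a * / 2 ^ r)); last by apply: Rmult_le_compat_l; lra.
  apply: (Rle_trans _ (INR a * / 2 ^ r0.+1)).
    apply: (Rmult_le_reg_r (2 ^ r0.+1)) => //.
    rewrite Rmult_assoc Rinv_l; last by have := P0 r0.+1; lra.
    by rewrite /=; lra.
  apply: Rmult_le_compat_l; first lra.
  by apply: Rinv_le_contravar => //; apply: Rle_pow; [lra | lia].
set ph := INR (below v r) / INR m.
pose p := (1 - / 2 ^ r) ^ a.
have phE : ph * INR m = INR (below t r) by rewrite /ph vE; field; lra.
have ph4 : / 4 <= ph by apply: (Rmult_le_reg_r (INR m)) => //; lra.
have dev' : Rabs (ph - p) <= eps / 128.
  apply: (Rmult_le_reg_l (INR m)) => //.
  rewrite -{1}(Rabs_right (INR m)) -?Rabs_mult; last lra.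
  by rewrite Rmult_minus_distr_l [INR m * ph]Rmult_comm phE.
have p8 : / 8 <= p by move/Rabs_le_inv: dev'; lra.
have lnp : ln p = INR a * y by rewrite /p ln_pow //; lra.
have hln : Rabs (ln ph - ln p) <= eps / 16.
  by have := @ln_lipschitz (/ 8) ph p ltac:(lra) ltac:(lra) ltac:(lra); lra.
have y0 : y < 0 by have := P1 r; lra.
have -> : estimator v - INR a = (ln ph - ln p) * / y.
  by rewrite /estimator -/r -/ph -/y lnp; field; lra.
rewrite Rabs_mult [Rabs (/ y)]Rabs_inv [Rabs y]Rabs_left //.
apply: (Rmult_le_reg_r (- y)); first lra.
rewrite Rmult_assoc Rinv_l; last lra.
nra.
Qed.

(** * Random tables *)

(** The number of leading zeros of [w] written with [L] bits: a geometric variable capped at [L]. *)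
Definition level L (w : 'I_(2 ^ L)) : nat := (L - up_log 2 w.+1)%N.

Lemma level_geE L (w : 'I_(2 ^ L)) r : (r <= L)%N ->
  (r <= level w)%N = (w < 2 ^ (L - r))%N.
Proof.
move=> hr; rewrite /level.
have hu : (up_log 2 w.+1 <= L)%N by apply: up_log_min.
have -> : (r <= L - up_log 2 w.+1)%N = (up_log 2 w.+1 <= L - r)%N by lia.
apply/idP/idP => [h|h]; last exact: up_log_min.
by apply: (leq_trans (up_logP w.+1 (isT : 1 < 2)%N)); rewrite leq_pexp2l.
Qed.

Lemma prob_level_lt L r : (r <= L)%N ->
  prob (fun w : 'I_(2 ^ L) => (level w < r)%N) = 1 - / 2 ^ r.
Proof.
move=> hr.
have N0 : (0 < #|'I_(2 ^ L)|)%N by rewrite card_ord expn_gt0.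
rewrite /prob (@eq_mean _ _ (fun w : 'I_(2 ^ L) => INR (~~ (w < 2 ^ (L - r))%N))); last first.
  by move=> w; rewrite -level_geE // -ltnNge.
rewrite [LHS](prob_not N0 (fun w : 'I_(2 ^ L) => (w < 2 ^ (L - r))%N)) prob_card card_ord.
have h : (2 ^ (L - r) <= 2 ^ L)%N by rewrite leq_pexp2l // leq_subr.
rewrite -sum1dep_card (big_ord_narrow h) sum1_card card_ord !INR_expn (_ : INR 2 = 2) //.
rewrite -{2}(subnK hr) pow_add.
have h1 := pow_lt 2 (L - r) ltac:(lra); have h2 := pow_lt 2 r ltac:(lra).
by congr (_ - _); field; lra.
Qed.

Lemma rprod_bool (I : finType) (P : pred I) :
  \rprod_(i : I) INR (P i) = INR [forall i, P i].
Proof.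
case: forallP => [h|h]; first by rewrite big1 // => i _; rewrite h.
have [i /negP/negbTE hi] := not_all_ex_not _ _ h.
by rewrite (bigD1 i) //= hi /= Rmult_0_l.
Qed.

(** A telescoping sum; it reduces the exponential moment of a level to its tail probabilities. *)
Lemma geometric_indicator d L :
  \rsum_(k : 'I_L) (/ 2 * (3 / 2) ^ k * INR (k < d)%N) = (3 / 2) ^ minn d L - 1.
Proof.
elim: L => [|L IH]; first by rewrite big_ord0 minn0 /=; lra.
rewrite big_ord_recr /= IH; case h : (L < d)%N.
  have -> : minn d L = L by lia.
  have -> : minn d L.+1 = L.+1 by lia.
  by rewrite /=; field.
have -> : minn d L.+1 = minn d L by lia.
by rewrite /=; ring.
Qed.

Lemma geometric_three_quarters L : \rsum_(k : 'I_L) (3 / 4) ^ k <= 4.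
Proof.
suff -> : \rsum_(k : 'I_L) (3 / 4) ^ k = 4 * (1 - (3 / 4) ^ L).
  by have := pow_lt (3 / 4) L ltac:(lra); lra.
elim: L => [|L IH]; first by rewrite big_ord0 /=; lra.
by rewrite big_ord_recr /= IH; field.
Qed.

Section Table.
Variables n m L : nat.
Local Notation bucket := {ffun 'I_n -> 'I_(2 ^ L)}.
Local Notation table := {ffun 'I_m -> bucket}.

Implicit Types A B : {set 'I_n}.

Definition top (w : bucket) (A : {set 'I_n}) : nat := \max_(x in A) level (w x).

Definition tops (th : table) (A : {set 'I_n}) : {ffun 'I_m -> nat} :=
  [ffun j => top (th j) A].

Lemma bucket_gt0 : (0 < #|{: bucket}|)%N.
Proof. by apply: card_ffun_gt0; rewrite card_ord expn_gt0. Qed.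

Lemma table_gt0 : (0 < #|{: table}|)%N.
Proof. exact: card_ffun_gt0 bucket_gt0. Qed.

Lemma top_le w A : (top w A <= L)%N.
Proof. by apply/bigmax_leqP => x _; exact: leq_subr. Qed.

Lemma leq_top (w : bucket) (A : {set 'I_n}) x : x \in A -> (level (w x) <= top w A)%N.
Proof. by move=> hx; rewrite /top (bigD1 x) //= leq_maxl. Qed.

Lemma topsU th A B : tops th (A :|: B) = ffun_max (tops th A) (tops th B).
Proof.
apply/ffunP => j; rewrite !ffunE; apply/eqP; rewrite eqn_leq geq_max.
apply/andP; split.
  apply/bigmax_leqP => x; rewrite inE leq_max => /orP [] hx; apply/orP.
    by left; apply: leq_top.
  by right; apply: leq_top.
by apply/andP; split; apply/bigmax_leqP => x hx; apply: leq_top;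
  rewrite inE hx ?orbT.
Qed.

Lemma prob_top_lt A r : A != set0 -> (r <= L)%N ->
  prob (fun w : bucket => (top w A < r)%N) = (1 - / 2 ^ r) ^ #|A|.
Proof.
move=> A0 hr.
have N0 : (0 < #|'I_(2 ^ L)|)%N by rewrite card_ord expn_gt0.
pose f (x : 'I_n) (y : 'I_(2 ^ L)) := INR ((x \in A) ==> (level y < r)%N).
rewrite /prob (@eq_mean _ _ (fun w : bucket => \rprod_(x : 'I_n) f x (w x))).
  rewrite mean_prod (eq_bigr (fun x => if x \in A then 1 - / 2 ^ r else 1)).
    by rewrite -big_mkcond (rprod_const _ (mem A)).
  move=> x _; rewrite /f; case: (x \in A) => /=; first exact: prob_level_lt.
  exact: mean_const.
move=> w; rewrite rprod_bool; congr (INR (nat_of_bool _)).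
apply/idP/forallP => [h x|h].
  apply/implyP => hx; apply: leq_ltn_trans h.
  exact: leq_top.
have {}h x : x \in A -> (level (w x) < r)%N by move/implyP: (h x).
(* At [r = 0] an empty maximum would break the equivalence; a member of [A] gives the
   contradiction. *)
case: r hr f h => [|r] hr f h; last by rewrite ltnS; apply/bigmax_leqP.
by case/set0Pn: A0 => x /h.
Qed.

Lemma prob_top_ge A r : A != set0 ->
  prob (fun w : bucket => (r <= top w A)%N) <= INR #|A| * / 2 ^ r.
Proof.
move=> A0; have P0 : 0 < / 2 ^ r by apply: Rinv_0_lt_compat; apply: pow_lt; lra.
case: (leqP r L) => hr.
  rewrite /prob (@eq_mean _ _ (fun w : bucket => INR (~~ (top w A < r)%N))).
    rewrite [X in X <= _](prob_not bucket_gt0) prob_top_lt //.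
    have := @bernoulli_ineq (/ 2 ^ r) #|A|.
    have : / 2 ^ r <= 1.
      rewrite -Rinv_1; apply: Rinv_le_contravar; first lra.
      by apply: pow_R1_Rle; lra.
    lra.
  by move=> w; rewrite -leqNgt.
rewrite /prob (@eq_mean _ _ (fun _ => 0)); last first.
  by move=> w; rewrite leqNgt (leq_ltn_trans (top_le w A) hr).
rewrite mean_const; last exact: bucket_gt0.
by apply: Rmult_le_pos; [exact: pos_INR | lra].
Qed.

(** The base 3/2 is below 2, so the tails [P (top >= q + k + 1) <= 2^-k / 8] outweigh the growth:
    the excess over 1 is at most [1/16] times the sum of [(3/4)^k], that is 1/4. *)
Lemma mean_pow_top A q : A != set0 -> 4 * INR #|A| <= 2 ^ q ->
  mean (fun w : bucket => (3 / 2) ^ (top w A - q)) <= 5 / 4.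
Proof.
move=> A0 hq; have q0 := pow_lt 2 q ltac:(lra).
rewrite (@eq_mean _ _ (fun w : bucket => 1 +
   \rsum_(k : 'I_L) (/ 2 * (3 / 2) ^ k * INR (k < top w A - q)%N))); last first.
  move=> w; rewrite geometric_indicator.
  by have -> : minn (top w A - q) L = (top w A - q)%N; [have := top_le w A; lia | ring].
rewrite meanD mean_const; last exact: bucket_gt0.
rewrite (mean_sum (fun (k : 'I_L) (w : bucket) => / 2 * (3 / 2) ^ k * INR (k < top w A - q)%N)).
suff : \rsum_(k : 'I_L) mean (fun w : bucket =>
          / 2 * (3 / 2) ^ k * INR (k < top w A - q)%N)
        <= \rsum_(k : 'I_L) (/ 16 * (3 / 4) ^ k).
  set S := \big[Rplus/0]_(k < L) mean _ => hS.
  have := geometric_three_quarters L.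
  by move: hS; rewrite -[X in _ <= X -> _]big_distrr /=; lra.
apply: rsum_le => k _; rewrite meanZ.
have -> : mean (fun w : bucket => INR (k < top w A - q)%N)
          = prob (fun w : bucket => (q + k.+1 <= top w A)%N).
  by apply: eq_mean => w; congr (INR (nat_of_bool _)); lia.
have := @prob_top_ge A (q + k.+1) A0.
have k0 := pow_lt 2 k ltac:(lra); have k1 := pow_lt (3 / 4) k ltac:(lra).
have : INR #|A| * / 2 ^ (q + k.+1) <= / 8 * / 2 ^ k.
  rewrite pow_add (_ : 2 ^ k.+1 = 2 * 2 ^ k) // (Rinv_mult (2 ^ q)) (Rinv_mult 2).
  have : INR #|A| * / 2 ^ q <= / 4.
    by apply: (Rmult_le_reg_r (2 ^ q)) => //; rewrite Rmult_assoc Rinv_l; lra.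
  move=> hA; rewrite -Rmult_assoc (_ : / 8 * _ = / 4 * (/ 2 * / 2 ^ k)); last by field; lra.
  apply: Rmult_le_compat_r => //.
  by have := Rinv_0_lt_compat _ k0; lra.
have -> : (3 / 4) ^ k = (3 / 2) ^ k * / 2 ^ k.
  by rewrite -pow_inv -Rpow_mult_distr; congr (_ ^ _); field.
have k2 := pow_lt (3 / 2) k ltac:(lra) => hA hp.
rewrite (_ : / 16 * _ = / 2 * (3 / 2) ^ k * (/ 8 * / 2 ^ k)); last by field; lra.
apply: Rmult_le_compat_l; lra.
Qed.

(** A cutoff above [q] means total excess at least [m], so that [(2/3)^m (3/2)^excess >= 1].
    Markov's inequality and independence of the buckets give [(2/3 * 5/4)^m]. *)
Lemma prob_cutoff_gt A q : A != set0 -> 4 * INR #|A| <= 2 ^ q ->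
  prob (fun th : table => (q < cutoff (tops th A))%N) <= (5 / 6) ^ m.
Proof.
move=> A0 hq.
pose f (w : bucket) := 2 / 3 * (3 / 2) ^ (top w A - q).
have f0 w : 0 <= f w by have := pow_lt (3 / 2) (top w A - q) ltac:(lra); rewrite /f; lra.
apply: (Rle_trans _ (mean (fun th : table => \rprod_(j : 'I_m) f (th j)))).
  apply: prob_le_mean => [|th|th h]; first exact: table_gt0.
    by elim/big_ind: _ => // [|x y]; [lra | exact: Rmult_le_pos].
  have {}h : (m <= excess (tops th A) q)%N.
    have : ~~ (excess (tops th A) q <= m.-1)%N.
      by apply/negP => /cutoff_le; lia.
    lia.
  rewrite /f big_split /= rprod_const -[#|_|]/(#|'I_m|) card_ord.
  have -> : \rprod_(j : 'I_m) (3 / 2) ^ (top (th j) A - q)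
            = (3 / 2) ^ excess (tops th A) q.
    rewrite /excess (big_morph _ (pow_add _) (pow_O _)).
    by apply: eq_bigr => j _; rewrite ffunE.
  rewrite -(subnKC h) pow_add -Rmult_assoc -Rpow_mult_distr.
  rewrite (_ : 2 / 3 * (3 / 2) = 1); last by field.
  by rewrite pow1 Rmult_1_l; apply: pow_R1_Rle; lra.
rewrite (mean_prod (fun _ => f)) rprod_const -[#|_|]/(#|'I_m|) card_ord.
apply: pow_incr; split.
  by rewrite -(mean_const bucket_gt0 0); apply: mean_le => //; exact: bucket_gt0.
rewrite /f meanZ (_ : 5 / 6 = 2 / 3 * (5 / 4)); last by field.
by apply: Rmult_le_compat_l; [lra | exact: mean_pow_top].
Qed.

(** The 17 is one term for the cutoff plus two Chernoff tails at each of eight levels. The condition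
    on [L] keeps the highest of them, [r0.+1], within the cap, where [prob_top_lt] is exact. *)
Lemma prob_bad_sketch A eps : (0 < m)%N -> (16 * n <= 2 ^ L)%N -> 0 < eps < 1 ->
  A != set0 ->
  prob (fun th : table =>
    bad_est (estimator (unpack (pack (tops th A)))) #|A| eps)
  <= 17 * exp (- (INR m * ((eps / 128) ^ 2 / 2))).
Proof.
move=> m0 hL heps A0; set a := #|A|; set E := exp _.
have a0 : (0 < a)%N by rewrite card_gt0.
have an : (a <= n)%N by rewrite -[n]card_ord max_card.
set r0 := up_log 2 (4 * a).
have /andP[ha2 ha1] : (2 ^ r0.-1 < 4 * a <= 2 ^ r0)%N.
  by apply: up_log_bounds => //; lia.
have r00 : (0 < r0)%N by rewrite up_log_gt0; lia.
have {}ha2 : (2 ^ r0 < 8 * a)%N by rewrite -(prednK r00) expnS; lia.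
have hr0 : (r0 < L)%N by rewrite -(ltn_exp2l _ _ (isT : 1 < 2)%N); lia.
pose t := eps / 128.
pose dev (r : nat) (th : table) := ltRb (INR #|'I_m| * t)
  (Rabs (INR #|[set j | (top (th j) A < r)%N]| - INR #|'I_m| *
     prob (fun w : bucket => (top w A < r)%N))).
apply: (Rle_trans _ (prob (fun th : table => (r0 < cutoff (tops th A))%N ||
          [exists i in 'I_8, dev (r0.+1 - i)%N th]))).
  apply: prob_le; first exact: table_gt0.
  move=> th; apply: contraTT; rewrite negb_or -leqNgt => /andP[hc /existsPn hd].
  rewrite /bad_est; case: Rlt_dec => // h; exfalso.
  apply: (Rlt_not_le _ _ h).
  apply: (@estimator_accurate _ _ _ r0) => //; first by apply/andP; split.
  move=> r hr; have i8 : (r0.+1 - r < 8)%N by lia.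
  apply: Rnot_lt_le => hlt; have := hd (Ordinal i8); rewrite /= => /negP; apply.
  rewrite (_ : (r0.+1 - (r0.+1 - r))%N = r); last by lia.
  apply/ltRbP; rewrite card_ord prob_top_lt //; last by lia.
  move: hlt; rewrite /t /below -/a.
  suff -> : [set j | (tops th A j < r)%N] = [set j | (top (th j) A < r)%N] by [].
  by apply/setP => j; rewrite !inE ffunE.
apply: Rle_trans (prob_or table_gt0 _ _) _.
have h1 : prob (fun th : table => (r0 < cutoff (tops th A))%N) <= E.
  apply: Rle_trans (prob_cutoff_gt A0 _) _.
    rewrite -/a -[2]/(INR 2) -INR_expn (_ : 4 = INR 4); last by rewrite /=; ring.
    by rewrite -mult_INR; apply: le_INR; lia.
  rewrite /E -Ropp_mult_distr_r_reverse exp_mulINR; apply: pow_incr.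
  by have := exp_ineq1_le (- ((eps / 128) ^ 2 / 2)); nra.
suff : prob (fun th : table => [exists i in 'I_8, dev (r0.+1 - i)%N th])
       <= INR #|'I_8| * (2 * E).
  move=> h2; apply: Rle_trans (Rplus_le_compat _ _ _ _ h1 h2) _.
  by rewrite card_ord [INR 8]/=; lra.
apply: (prob_exists table_gt0 (P := fun i : 'I_8 => dev (r0.+1 - i)%N)) => i _.
have ht : 0 < t <= / 2 by rewrite /t; lra.
have -> : E = exp (- (INR #|'I_m| * (t ^ 2 / 2))) by rewrite card_ord.
exact: (@chernoff _ (fun w : bucket => (top w A < r0.+1 - i)%N) bucket_gt0 'I_m t).
Qed.

End Table.

(** * Data structures *)

Lemma nat_floor x : 0 <= x -> exists k : nat, INR k <= x < INR k + 1.
Proof.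
move=> x0; have [h1 h2] := archimed x.
have z0 : (0 < up x)%Z by apply: lt_IZR; lra.
exists (Z.to_nat (up x - 1)); rewrite INR_IZR_INZ Z2Nat.id; last by lia.
by rewrite minus_IZR; lra.
Qed.

(** The factor 2 comes from [ln 2 > 1 / 2], the summand 1 from rounding up. *)
Lemma up_log2_le_ln k : (0 < k)%N -> INR (up_log 2 k) <= 2 * ln (INR k) + 1.
Proof.
move=> k0; have [k1|k1] := leqP k 1.
  have -> : k = 1%N by lia.
  by rewrite up_log1 /= ln_1; lra.
have /andP[h _] := up_log_bounds (isT : 1 < 2)%N k1.
have u0 : (0 < up_log 2 k)%N by rewrite up_log_gt0.
have : INR (up_log 2 k).-1 * ln 2 <= ln (INR k).
  rewrite -ln_pow; last lra.
  apply: ln_le; first by apply: pow_lt; lra.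
  by rewrite -[2]/(INR 2) -INR_expn; apply: le_INR; lia.
have := pos_INR (up_log 2 k).-1; have := ln_lt_2.
have -> : INR (up_log 2 k) = INR (up_log 2 k).-1 + 1 by rewrite -S_INR prednK.
nra.
Qed.

Lemma up_log2_mul a b : (up_log 2 (a * b) <= up_log 2 a + up_log 2 b)%N.
Proof.
by apply: up_log_min => //; rewrite expnD leq_mul // up_logP.
Qed.

(** Equal lengths make the code usable as a decodable prefix in [MCE_refine]. *)
Lemma fixed_length_code K :
  exists c : 'I_K -> seq bool, injective c /\ forall i, size (c i) = up_log 2 K.
Proof.
set w := up_log 2 K.
have hK : (K <= #|{: w.-tuple bool}|)%N by rewrite card_tuple card_bool up_logP.
exists (fun i => tval (enum_val (widen_ord hK i))); split=> [i j /val_inj|i].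
  by move/enum_val_inj => /(congr1 val) /= /val_inj.
by rewrite size_tuple.
Qed.

Lemma space_le n (D : MCE n) a b : (#|seed D| <= a)%N ->
  (forall (th : seed D) A, A != set0 -> (size (enc (nu th A)) <= b)%N) ->
  (space D <= up_log 2 a + b)%N.
Proof.
move=> ha hb; rewrite /space leq_add //; first exact: leq_up_log.
by apply/bigmax_leqP => th _; apply/bigmax_leqP => A; exact: hb.
Qed.

Lemma size_enc_le_space n (D : MCE n) (th : seed D) A : A != set0 ->
  (up_log 2 #|seed D| + size (enc (nu th A)) <= space D)%N.
Proof.
move=> A0; rewrite /space leq_add2l (bigD1 th) //= (bigD1 A) //=.
by rewrite !leq_max leqnn.
Qed.

Definition good_seeds n (D : MCE n) eps (A : {set 'I_n}) : {set seed D} :=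
  [set th | ~~ bad_est (estimate (nu th A)) #|A| eps].

Lemma fail_probE n (D : MCE n) eps A : (0 < #|seed D|)%N ->
  fail_prob D eps A = 1 - INR #|good_seeds D eps A| / INR #|seed D|.
Proof.
move=> h; rewrite /fail_prob.
rewrite -(cardsC [set th | bad_est (estimate (nu th A)) #|A| eps]) plus_INR.
have -> : ~: [set th | bad_est (estimate (nu th A)) #|A| eps]
          = good_seeds D eps A by apply/setP => th; rewrite !inE.
have := INR_card_gt0 h.
rewrite -(cardsC [set th | bad_est (estimate (nu th A)) #|A| eps]) plus_INR.
have -> : ~: [set th | bad_est (estimate (nu th A)) #|A| eps]
          = good_seeds D eps A by apply/setP => th; rewrite !inE.
by move=> ?; field; lra.
Qed.

Lemma bad_estP x a eps : reflect (eps * INR a < Rabs (x - INR a)) (bad_est x a eps).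
Proof. by rewrite /bad_est; case: Rlt_dec => h; constructor. Qed.

(** * The derandomized sketch for failure probability at most 1/2 *)

Section Hashed.
Variables (n m L N : nat).
Hypothesis m0 : (0 < m)%N.
Variable s : {ffun 'I_N -> {ffun 'I_m -> {ffun 'I_n -> 'I_(2 ^ L)}}}.

Definition hashed_MCE : MCE n :=
  @MkMCE n 'I_N (nat * {ffun 'I_m -> nat})%type (@enc_packed m) (@enc_packed_inj m)
    (fun x k => pack (tops (s k) [set x])) (@merge_packed m)
    (fun v => estimator (unpack v)) (fun k A => pack (tops (s k) A)).

Lemma space_hashed_MCE : (space hashed_MCE <= up_log 2 N + (L + 2 * m))%N.
Proof.
apply: space_le; first by rewrite card_ord.
by move=> k A _; apply: size_enc_pack => // j; rewrite ffunE top_le.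
Qed.

End Hashed.

Lemma MCE_small_failure n eps delta : (0 < n)%N -> 0 < eps < 1 -> 0 < delta <= / 2 ->
  exists D : MCE n, is_MCE D eps delta /\
    INR (space D) <= 10000000 * (ln (/ delta) / eps ^ 2 + ln (INR n) + 1).
Proof.
move=> n0 heps hd; set D := ln (/ delta).
have nR : 1 <= INR n by rewrite -[1]/(INR 1); apply: le_INR; lia.
have id2 : 2 <= / delta by rewrite -(Rinv_inv 2); apply: Rinv_le_contravar; lra.
have D2 : / 2 <= D by have := @ln_le 2 (/ delta) ltac:(lra) id2; have := ln_lt_2; rewrite -/D; lra.
have e0 : 0 < eps ^ 2 <= 1 by nra.
have ln68 : ln (68 / delta) = ln 68 + D by rewrite ln_mult //; lra.
have ln68b : 0 < ln 68 <= 67.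
  split; last by have := @ln_le_sub1 68; lra.
  by rewrite -ln_1; apply: ln_increasing; lra.
(* Here [32768 = 2 * 128^2] matches the Chernoff exponent, and [68 = 4 * 17] yields the failure
   probability [delta / 4] that [derandomize] requires. *)
pose x := 32768 * (ln 68 + D) / eps ^ 2.
have x0 : 0 < x by apply: Rdiv_lt_0_compat; lra.
have [m' hm'] := nat_floor (Rlt_le _ _ x0); pose m := m'.+1.
have hm : x < INR m <= x + 1 by rewrite S_INR; lra.
pose y := 2 * INR n / delta.
have y0 : 0 < y by apply: Rdiv_lt_0_compat; lra.
have [N' hN'] := nat_floor (Rlt_le _ _ y0); pose N := N'.+1.
have hN : y < INR N <= y + 1 by rewrite S_INR; lra.
pose L := (up_log 2 n + 4)%N.
have hL : (16 * n <= 2 ^ L)%N.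
  by have := up_logP n (isT : 1 < 2)%N; rewrite expnD; lia.
pose table := {ffun 'I_m -> {ffun 'I_n -> 'I_(2 ^ L)}}.
(* The empty set is declared never bad, so that the union bound can run over all [2^n] sets. *)
pose bad (A : {set 'I_n}) (th : table) := (A != set0) &&
  bad_est (estimator (unpack (pack (tops th A)))) #|A| eps.
have bad4 A : prob (bad A) <= delta / 4.
  case A0 : (A == set0).
    rewrite /prob (@eq_mean _ _ (fun _ => 0)); last by move=> th; rewrite /bad A0.
    by rewrite mean_const; [lra | exact: table_gt0].
  have {}A0 : A != set0 by rewrite A0.
  have h := @prob_bad_sketch n m L A eps isT hL heps A0.
  rewrite /prob (@eq_mean _ _ (fun th : table => INR
     (bad_est (estimator (unpack (pack (tops th A)))) #|A| eps))); last first.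
    by move=> th; rewrite /bad A0.
  apply: Rle_trans h _.
  suff : exp (- (INR m * ((eps / 128) ^ 2 / 2))) <= delta / 68 by lra.
  have -> : delta / 68 = exp (- (ln 68 + D)).
    rewrite -ln68 exp_Ropp exp_ln; first by field; lra.
    by apply: Rdiv_lt_0_compat; lra.
  apply: exp_le; apply: Ropp_le_contravar.
  have -> : ln 68 + D = x * (eps ^ 2 / 32768) by rewrite /x; field; lra.
  rewrite (_ : (eps / 128) ^ 2 / 2 = eps ^ 2 / 32768); last by field.
  by apply: Rmult_le_compat_r; lra.
have cI : (#|{set 'I_n}| <= 2 ^ n)%N.
  by rewrite -cardsT -powersetT card_powerset cardsT card_ord.
have h2 : 2 * INR n <= delta * INR N.
  have -> : 2 * INR n = delta * y by rewrite /y; field; lra.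
  by apply: Rmult_le_compat_l; lra.
have [s hs] := derandomize (table_gt0 n m L) n0 cI bad4 h2.
exists (hashed_MCE s); split.
  split; first by rewrite card_ord.
  split=> [//|]; split=> [k A B _ _|A A0].
    by rewrite /= merge_pack // topsU.
  rewrite /fail_prob /= card_ord; apply: (Rmult_le_reg_r (INR N)); first lra.
  rewrite /Rdiv Rmult_assoc Rinv_l ?Rmult_1_r; last lra.
  apply: Rle_trans (hs A); apply: le_INR; apply/leP; apply: subset_leq_card.
  by apply/subsetP => k; rewrite !inE /bad A0.
apply: (Rle_trans _ (INR (up_log 2 N + (L + 2 * m))%N)).
  by apply: le_INR; apply/leP; exact: space_hashed_MCE.
have -> : INR (up_log 2 N + (L + 2 * m))%N
          = INR (up_log 2 N) + (INR (up_log 2 n) + 4 + 2 * INR m).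
  rewrite [LHS]plus_INR [X in _ + X]plus_INR [X in _ + (X + _)]plus_INR.
  by rewrite [X in _ + (_ + X)](mult_INR 2 m) /=; ring.
have hT := @up_log2_le_ln N isT; have hU := up_log2_le_ln n0.
have lnN : ln (INR N) <= 2 + ln (INR n) + D.
  apply: (Rle_trans _ (ln (3 * INR n * / delta))).
    apply: ln_le; first lra.
    have : 1 <= INR n * / delta by nra.
    by rewrite /y /Rdiv in hN; lra.
  rewrite !ln_mult; try lra.
  by have := @ln_le_sub1 3; rewrite -/D; lra.
have De : D <= D / eps ^ 2.
  rewrite -{1}(Rdiv_1_r D); apply: Rmult_le_compat_l; first lra.
  by apply: Rinv_le_contravar; lra.
(* [ln 68 <= 67] and [D >= 1 / 2] give [ln 68 + D <= 135 D], and [135 * 32768 = 4423680]. *)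
have xD : x <= 4423680 * (D / eps ^ 2).
  rewrite /x (_ : 4423680 * (D / eps ^ 2) = 4423680 * D / eps ^ 2); last by field; lra.
  apply: Rmult_le_compat_r; last lra.
  by apply: Rlt_le; apply: Rinv_0_lt_compat; lra.
have ln0 : 0 <= ln (INR n) by rewrite -ln_1; apply: ln_le; lra.
lra.
Qed.

(** The seed is itself the guess, shifted by one because [A] is nonempty, and the sketch only
    repeats it. Exactness for one seed in [n] suffices. *)
Lemma MCE_guess n eps : (0 < n)%N -> 0 < eps ->
  exists D : MCE n, is_MCE D eps (1 - / INR n) /\ (space D <= 2 * up_log 2 n)%N.
Proof.
move=> n0 eps0; have [c [cI cS]] := fixed_length_code n.
pose D : MCE n := @MkMCE n 'I_n 'I_n c cI (fun _ k => k) (fun k _ => k)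
  (fun k => INR k.+1) (fun k _ => k).
have D0 : (0 < #|seed D|)%N by rewrite card_ord.
exists D; split; last first.
  rewrite mul2n -addnn; apply: space_le; first by rewrite card_ord.
  by move=> k A _; rewrite cS.
do 3!split=> //; move=> A A0; rewrite fail_probE // card_ord.
have nR : 0 < INR n by apply: lt_0_INR; lia.
suff : 1 <= INR #|good_seeds D eps A|.
  move=> h; have := Rinv_0_lt_compat _ nR; rewrite /Rdiv; nra.
rewrite -[1]/(INR 1); apply: le_INR; apply/leP; rewrite card_gt0.
have a0 : (0 < #|A|)%N by rewrite card_gt0.
have an : (#|A|.-1 < n)%N.
  by rewrite prednK // -[X in (_ <= X)%N]card_ord max_card.
apply/set0Pn; exists (Ordinal an); rewrite inE; apply/bad_estP.
rewrite -[estimate _]/(INR #|A|.-1.+1) prednK // Rminus_diag Rabs_R0.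
have := Rmult_le_pos _ _ (Rlt_le _ _ eps0) (pos_INR #|A|); lra.
Qed.

(* Multiplying a coarse estimate by a random point of a grid of step [eps / 2]
   around [1] hits the accuracy [eps] with probability [1 / K]. *)
Lemma MCE_refine n (D0 : MCE n) e eps K :
  (0 < K)%N -> 0 < e <= / 2 -> 0 < eps < 1 -> 8 * e <= INR K * eps ->
  is_MCE D0 e (/ 2) ->
  exists D : MCE n, is_MCE D eps (1 - / (2 * INR K)) /\
    (space D <= space D0 + 2 * up_log 2 K)%N.
Proof.
move=> K0 he heps heK [D00 [hsing [hmerge hfail]]].
have [c [cI cS]] := fixed_length_code K.
pose en (v : sketch D0 * 'I_K) := c v.2 ++ enc v.1.
have enI : injective en.
  move=> [v i] [v' i'] /eqP; rewrite eqseq_cat ?cS // => /andP[/eqP h1 /eqP h2].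
  by congr (_, _); [exact: enc_inj h2 | exact: cI h1].
pose D : MCE n := @MkMCE n (seed D0 * 'I_K)%type (sketch D0 * 'I_K)%type en enI
  (fun x th => (single x th.1, th.2)) (fun v v' => (Defs.merge v.1 v'.1, v.2))
  (fun v => estimate v.1 * (1 - e + INR v.2 * (eps / 2)))
  (fun th A => (nu th.1 A, th.2)).
have DE : #|seed D| = (#|seed D0| * K)%N by rewrite card_prod card_ord.
have DD0 : (0 < #|seed D|)%N by rewrite DE muln_gt0 D00.
exists D; split; last first.
  set M := \max_(th : seed D0) \max_(A : {set 'I_n} | A != set0) size (enc (nu th A)).
  apply: (@leq_trans (up_log 2 (#|seed D0| * K) + (M + up_log 2 K))).
    apply: space_le; first by rewrite DE.
    move=> [th i] A A0; rewrite /= /en size_cat cS addnC leq_add2r /=.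
    by have := @size_enc_le_space n D0 th A A0; rewrite /space leq_add2l.
  by have := up_log2_mul #|seed D0| K; rewrite /space -/M; lia.
split=> //; split=> [[th i] x|]; first by rewrite /= hsing.
split=> [[th i] A B A0 B0|A A0]; first by rewrite /= hmerge.
have KR : 0 < INR K by apply: lt_0_INR; lia.
have SR := INR_card_gt0 D00.
have aR : 0 < INR #|A| by apply: lt_0_INR; apply/ltP; rewrite card_gt0.
have := hfail A A0; rewrite !fail_probE // DE mult_INR => hg.
(* Each good coarse seed extends by some grid index to a good seed, so good seeds have proportion at
   least [(1 / 2) / K]. *)
have sub : good_seeds D0 e A \subset fst @: good_seeds D eps A.
  apply/subsetP => th; rewrite inE => /bad_estP /Rnot_lt_le /Rabs_le_inv.
  set y := estimate _ => hy.
  have y0 : 0 < y by nra.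
  (* The ideal correction factor lies in [[1 - e, 1 + 2 e]], an interval of length
     [3 e < K * eps / 2], hence covered by the grid. *)
  pose sc := INR #|A| / y.
  have scy : sc * y = INR #|A| by rewrite /sc; field; lra.
  have sc1 : 1 - e <= sc by apply: (Rmult_le_reg_r y) => //; nra.
  have sc2 : sc <= 1 + 2 * e by apply: (Rmult_le_reg_r y) => //; nra.
  have [|k hk] := @nat_floor ((sc - (1 - e)) / (eps / 2)).
    by apply: Rmult_le_pos; [lra | apply: Rlt_le; apply: Rinv_0_lt_compat; lra].
  set q := (sc - (1 - e)) / (eps / 2) in hk.
  have qE : q * (eps / 2) = sc - (1 - e) by rewrite /q; field; lra.
  have kK : (k < K)%N.
    apply/ltP; apply: INR_lt; apply: (Rmult_lt_reg_r (eps / 2)); first lra.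
    have : INR k * (eps / 2) <= q * (eps / 2) by apply: Rmult_le_compat_r; lra.
    lra.
  apply/imsetP; exists (th, Ordinal kK) => //; rewrite inE /=; apply/bad_estP.
  apply: Rle_not_lt; rewrite -/y -scy.
  set z := 1 - e + INR k * (eps / 2).
  have hz : Rabs (z - sc) <= eps / 2.
    have h1 : INR k * (eps / 2) <= q * (eps / 2) by apply: Rmult_le_compat_r; lra.
    have h2 : q * (eps / 2) <= (INR k + 1) * (eps / 2) by apply: Rmult_le_compat_r; lra.
    by apply: Rabs_le; rewrite /z; lra.
  rewrite (_ : y * z - sc * y = (z - sc) * y); last by ring.
  rewrite Rabs_mult (Rabs_right y); last lra.
  rewrite -Rmult_assoc; apply: Rmult_le_compat_r; first lra.
  (* [sc >= 1 - e >= 1 / 2], so the grid error [eps / 2] is at most [eps * sc]. *)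
  by nra.
have {sub} : (#|good_seeds D0 e A| <= #|good_seeds D eps A|)%N.
  exact: leq_trans (subset_leq_card sub) (leq_imset_card _ _).
move=> /leP /le_INR hc.
have {}hg : / 2 * INR #|seed D0| <= INR #|good_seeds D0 e A|.
  have : INR #|good_seeds D0 e A| / INR #|seed D0| * INR #|seed D0|
         = INR #|good_seeds D0 e A| by field; lra.
  nra.
suff : / (2 * INR K) <= INR #|good_seeds D eps A| / (INR #|seed D0| * INR K) by lra.
have SK : 0 < INR #|seed D0| * INR K by nra.
apply: (Rmult_le_reg_r _ _ _ SK).
rewrite /Rdiv Rmult_assoc Rinv_l; last lra.
have -> : / (2 * INR K) * (INR #|seed D0| * INR K) = / 2 * INR #|seed D0|.
  by field; lra.
lra.
Qed.

Theorem theorem16 :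
  exists C : R, (0 < C)%R /\
    forall (n : nat) (eps delta : R),
      (1 <= n)%nat -> (0 < eps < 1)%R -> (0 < delta < 1)%R ->
      exists D : MCE n,
        is_MCE D eps delta /\
        (INR (space D) <= C * (ln (/ delta) / (eps ^ 2) + ln (INR n) + 1))%R.
Proof.
(* The dominant term is [1024 * 10^7], from the coarse sketch in the last case. *)
exists 20000000000; split; first lra.
move=> n eps delta n0 heps hd; set D := ln (/ delta).
have nR : 1 <= INR n by rewrite -[1]/(INR 1); apply: le_INR; lia.
have ln0 : 0 <= ln (INR n) by rewrite -ln_1; apply: ln_le; lra.
have e0 : 0 < eps ^ 2 by nra.
have ie0 := Rinv_0_lt_compat _ e0.
have Dp : 1 - delta <= D.
  by rewrite /D ln_Rinv; last lra; have := @ln_le_sub1 delta; lra.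
have D0 : 0 <= D / eps ^ 2 by apply: Rmult_le_pos; lra.
have weaken D' d' : d' <= delta -> is_MCE D' eps d' -> @is_MCE n D' eps delta.
  move=> hd' [h1 [h2 [h3 h4]]]; do 3!split=> //.
  by move=> A A0; have := h4 A A0; lra.
have [d2|d2] := Rle_dec delta (/ 2).
  have [D' [h1 h2]] := MCE_small_failure n0 heps (conj (proj1 hd) d2).
  by exists D'; split=> //; rewrite -/D in h2; lra.
set p := 1 - delta in Dp.
have hp : 0 < p < / 2 by rewrite /p; lra.
have hlog := up_log2_le_ln n0.
have [np|np] := Rle_dec (INR n * p) 1.
  have [D' [h1 h2]] := MCE_guess n0 (proj1 heps).
  exists D'; split.
    apply: weaken h1; suff : p <= / INR n by rewrite /p; lra.
    by apply: (Rmult_le_reg_l (INR n)); rewrite ?Rinv_r; lra.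
  move/leP/le_INR: h2; rewrite mult_INR (_ : INR 2 = 2) //; lra.
(* [K] is the floor of [x]: rounding down gives [p <= 1 / (2 K)], the required success probability,
   while [x > 1] keeps [K] at least [x / 2], hence [K p >= 1 / 4]. *)
pose x := / (2 * p).
have xp : x * (2 * p) = 1 by rewrite /x Rinv_l; lra.
have x1 : 1 < x by nra.
have [K hK] := @nat_floor x ltac:(lra).
have K0 : (0 < K)%N by case: K hK => // ; rewrite /=; lra.
have K1 : 1 <= INR K by rewrite -[1]/(INR 1); apply: le_INR; lia.
have Kn : INR K <= INR n by nra.
have Kp : / 4 <= INR K * p by nra.
pose e := Rmin (/ 2) (INR K * eps / 8).
have eK0 : 0 < INR K * eps by nra.
have he : 0 < e <= / 2 by rewrite /e; split; [apply: Rmin_glb_lt; lra | exact: Rmin_l].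
have heK : 8 * e <= INR K * eps.
  by have := Rmin_r (/ 2) (INR K * eps / 8); rewrite -/e; lra.
have [D1 [h1 h2]] := @MCE_small_failure n e (/ 2) n0 ltac:(lra) ltac:(lra).
have [D' [h3 h4]] := MCE_refine K0 he heps heK h1.
exists D'; split.
  apply: weaken h3; suff : p <= / (2 * INR K) by rewrite /p; lra.
  by apply: (Rmult_le_reg_l (2 * INR K)); rewrite ?Rinv_r; nra.
(* Either [e = 1 / 2], or [1 / e^2 = 64 / (K eps)^2] with [1 / K^2 <= 16 p^2 <= 16 D], since
   [p <= 1] and [p <= D]. *)
have he2 : / e ^ 2 <= 4 + 1024 * (D / eps ^ 2).
  rewrite /e /Rmin; case: Rle_dec => _.
    by rewrite (_ : / (/ 2) ^ 2 = 4); [lra | field].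
  have -> : / (INR K * eps / 8) ^ 2 = 64 * / (INR K ^ 2) * / eps ^ 2 by field; lra.
  have iK : / (INR K ^ 2) <= 16 * D.
    apply: (Rmult_le_reg_l (INR K ^ 2)); first nra.
    rewrite Rinv_r; last nra.
    apply: (Rle_trans _ (INR K ^ 2 * (16 * (p * p)))); first nra.
    apply: Rmult_le_compat_l; first nra.
    nra.
  have := Rmult_le_compat_r _ _ _ (Rlt_le _ _ ie0) iK; rewrite /Rdiv; lra.
have hlK := up_log2_le_ln K0.
have lnK : ln (INR K) <= ln (INR n) by apply: ln_le; lra.
have ln2 : ln (/ / 2) / e ^ 2 <= / e ^ 2.
  rewrite Rinv_inv -[X in _ <= X]Rmult_1_l; apply: Rmult_le_compat_r.
    by apply: Rlt_le; apply: Rinv_0_lt_compat; nra.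
  by have := @ln_le_sub1 2; lra.
move/leP/le_INR: h4.
rewrite (plus_INR (space D1)) (mult_INR 2 (up_log 2 K)) (_ : INR 2 = 2) //.
lra.
Qed.
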